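(* Let $K$ be an integer, let $(G,w)$ be a $2K$-unbalanced pair, let $\mathcal{S}$ be a set of unordered pairs $\{K_1,K_2\}$ of cliques of $G$ each of size at most $K$ such that every two of the corresponding canonical two-clique-separations are loosely non-crossing, and let $\beta$ be a central bag for $\mathcal{S}$ with inherited weight function $w_\beta$ (as defined in the context). Let $d,\Delta$ be integers, and assume that $|\delta_{\mathcal{S}}(v)|\le\Delta$ for every $v\in V(G)$ and that $(\beta,w_\beta)$ is $d$-balanced. Then $(G,w)$ is $\max(2Kd,\Delta d)$-balanced.
   Context: A weight function on $G$ is $w:V(G)\to[0,1]$ with $w(V(G))=1$, where $w(X)=\sum_{x\in X}w(x)$. For a graph $H$ and a function $u:V(H)\to[0,1]$, a set $X\subseteq V(H)$ is a $(u,\tfrac12)$-balanced separator if every component $D$ of $H\setminus X$ has $u(D)\le\tfrac12$; $(H,u)$ is $d$-unbalanced if $H$ has no $(u,\frac12)$-balanced separator of size at most $d$, and $d$-balanced otherwise. Given $(G,w)$ $2K$-unbalanced and cliques $K_1,K_2$ of size at most $K$, let $B(K_1,K_2)$ be the (unique) component of $G\setminus(K_1\cup K_2)$ of maximum weight (its weight exceeds $\tfrac12$), $C(K_1,K_2)=K_1\cup K_2$, $A(K_1,K_2)=V(G)\setminus(B(K_1,K_2)\cup K_1\cup K_2)$; $S(K_1,K_2)=(A,C,B)$ is the canonical two-clique-separation. Two such separations $(A_1,C_1,B_1),(A_2,C_2,B_2)$ are loosely non-crossing if $A_1\cap C_2=A_2\cap C_1=\emptyset$. Central bag: fix a total order $\pi$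 on $\mathcal{S}$; let $U=\bigcup_{\{K_1,K_2\}\in\mathcal{S}}A(K_1,K_2)$ (each component of $G[U]$ lies in some $A(K_1,K_2)$). For $\{K_1,K_2\}\in\mathcal{S}$ let $A^*(K_1,K_2)$ be the union of the components $D$ of $G[U]$ for which $\{K_1,K_2\}$ is the $\pi$-minimal member of $\mathcal{S}$ with $D\subseteq A(K_1,K_2)$. Let $\mathcal{S}'=\{\{K_1,K_2\}\in\mathcal{S}: A^*(K_1,K_2)\ne\emptyset\}$, and for each $\{K_1,K_2\}\in\mathcal{S}'$ let $P_{K_1K_2}$ be an induced path from a vertex of $K_1$ to a vertex of $K_2$ whose interior $P^*_{K_1K_2}$ is a nonempty subset of $A^*(K_1,K_2)$, and let $a_{K_1,K_2}\in P^*_{K_1K_2}$ be the vertex adjacent to the end of $P_{K_1K_2}$ in $K_1$. Let $Z=\bigcap_{\{K_1,K_2\}\in\mathcal{S}'}(B(K_1,K_2)\cup K_1\cup K_2)$ and $\beta=G[Z\cup\bigcup_{\{K_1,K_2\}\in\mathcal{S}'}V(P_{K_1K_2})]$. The inherited weight function $w_\beta$ on $V(\beta)$ is: $w_\beta(v)=w(v)$ for $v\in Z$; $w_\beta(a_{K_1,K_2})=w(A^*(K_1,K_2))$ for $\{K_1,K_2\}\in\mathcal{S}'$; $w_\beta(v)=0$ otherwise. For $v\in V(G)$, $\delta_{\mathcal{S}}(v)$ is the union of all cliques $K'$ with $v\in K'$ such that $\{K',L\}\in\mathcal{S}$ for some $L$.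
   Formalization: K is taken to be a positive integer; for K ≤ 0 the claim fails (e.g. K=0, G a three-vertex path with weights 1/3, S empty, Δ=0, d=1: β=G is 1-balanced but G is not 0-balanced). *)

(* Defs.v *)
From mathcomp Require Import all_boot all_order all_algebra.

Set Implicit Arguments.
Unset Strict Implicit.
Unset Printing Implicit Defensive.

Import Order.TTheory GRing.Theory Num.Theory.
Local Open Scope ring_scope.

(* A finite simple graph G is a symmetric irreflexive [e : rel T] on a finType
   [T] of vertices; the induced subgraph G[W] is represented by its vertex set
   [W : {set T}], so G itself is [W = setT]. *)

Definition induced_rel (T : finType) (e : rel T) (W : {set T}) : rel T :=
  [rel x y | [&& x \in W, y \in W & e x y]].

Definition components (T : finType) (e : rel T) (W : {set T}) : {set {set T}} :=
  [set [set y | connect (induced_rel e W) x y] | x in W].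

Definition clique (T : finType) (e : rel T) (K : {set T}) : bool :=
  [forall x in K, forall y in K, (x != y) ==> e x y].

Definition induced_path (T : finType) (e : rel T) (s : seq T) : Prop :=
  uniq s /\
  forall (x0 : T) (i j : nat), (i < size s)%N -> (j < size s)%N ->
    e (nth x0 s i) (nth x0 s j) = (j == i.+1) || (i == j.+1).

Definition weight (R : realFieldType) (T : finType) (u : T -> R) (X : {set T}) : R :=
  \sum_(x in X) u x.

Definition weight_function (R : realFieldType) (T : finType) (w : T -> R) : Prop :=
  (forall x, 0 <= w x <= 1) /\ weight w [set: T] = 1.

Definition balanced_separator (R : realFieldType) (T : finType) (e : rel T)
    (W : {set T}) (u : T -> R) (X : {set T}) : bool :=
  (X \subset W) && [forall D in components e (W :\: X), weight u D <= 1 / 2].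

Definition balanced (R : realFieldType) (T : finType) (e : rel T)
    (W : {set T}) (u : T -> R) (d : int) : bool :=
  [exists X : {set T}, balanced_separator e W u X && (#|X|%:Z <= d)].

Definition unbalanced (R : realFieldType) (T : finType) (e : rel T)
    (W : {set T}) (u : T -> R) (d : int) : bool :=
  ~~ balanced e W u d.

(* An unordered pair {K1, K2} of vertex sets is [[set K1; K2] : {set {set T}}];
   K1 = K2 is not excluded. *)

Definition sepC (T : finType) (p : {set {set T}}) : {set T} := cover p.

(* The maximum is attained by a unique component whenever some component has
   weight > 1/2; the default value [set0] is then never used. *)
Definition sepB (R : realFieldType) (T : finType) (e : rel T) (w : T -> R)
    (p : {set {set T}}) : {set T} :=
  odflt set0 [pick D in components e (~: sepC p) |
               [forall D' in components e (~: sepC p), weight w D' <= weight w D]].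

Definition sepA (R : realFieldType) (T : finType) (e : rel T) (w : T -> R)
    (p : {set {set T}}) : {set T} :=
  ~: (sepB e w p :|: sepC p).

Definition loosely_non_crossing (R : realFieldType) (T : finType) (e : rel T)
    (w : T -> R) (p q : {set {set T}}) : Prop :=
  sepA e w p :&: sepC q = set0 /\ sepA e w q :&: sepC p = set0.

Definition clique_pair (T : finType) (e : rel T) (K : int) (p : {set {set T}}) : Prop :=
  exists K1 K2 : {set T},
    [/\ p = [set K1; K2], clique e K1 /\ clique e K2,
        #|K1|%:Z <= K & #|K2|%:Z <= K].

Definition delta (T : finType) (S : {set {set {set T}}}) (v : T) : {set T} :=
  \bigcup_(K' : {set T} | (v \in K') && [exists L : {set T}, [set K'; L] \in S]) K'.

(* Reflexivity on S is a consequence of totality. *)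
Definition total_order_on (I : finType) (S : {set I}) (le : rel I) : Prop :=
  [/\ {in S &, total le}, {in S &, antisymmetric le} & {in S & &, transitive le}].

Definition unionA (R : realFieldType) (T : finType) (e : rel T) (w : T -> R)
    (S : {set {set {set T}}}) : {set T} :=
  \bigcup_(p in S) sepA e w p.

Definition Astar (R : realFieldType) (T : finType) (e : rel T) (w : T -> R)
    (S : {set {set {set T}}}) (le : rel {set {set T}}) (p : {set {set T}}) : {set T} :=
  \bigcup_(D in components e (unionA e w S) |
             (D \subset sepA e w p)
             && [forall q in S, (D \subset sepA e w q) ==> le p q]) D.

Definition Sprime (R : realFieldType) (T : finType) (e : rel T) (w : T -> R)
    (S : {set {set {set T}}}) (le : rel {set {set T}}) : {set {set {set T}}} :=
  [set p in S | Astar e w S le p != set0].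

(* [s] lists the vertices of an induced path from K1 to K2 whose interior is
   nonempty and contained in [Q]; [a] is the interior vertex adjacent to the
   end of the path in K1. *)
Definition linking_path (T : finType) (e : rel T) (K1 K2 Q : {set T})
    (s : seq T) (a : T) : Prop :=
  exists (x y : T) (q : seq T),
    [/\ s = x :: rcons q y, induced_path e s,
        x \in K1 /\ y \in K2,
        q != [::] /\ {subset q <= Q}
      & a \in q /\ e a x].

(* The choices made in building a central bag: a total order on S and, for each
   member of S', a path and its distinguished vertex.  Which of the two cliques
   of the unordered pair plays the role of K1 is part of the choice. *)
Definition central_bag_data (R : realFieldType) (T : finType) (e : rel T)
    (w : T -> R) (S : {set {set {set T}}}) (le : rel {set {set T}})
    (P : {set {set T}} -> seq T) (a : {set {set T}} -> T) : Prop :=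
  total_order_on S le /\
  forall p, p \in Sprime e w S le ->
    exists K1 K2 : {set T},
      p = [set K1; K2] /\ linking_path e K1 K2 (Astar e w S le p) (P p) (a p).

Definition bagZ (R : realFieldType) (T : finType) (e : rel T) (w : T -> R)
    (S : {set {set {set T}}}) (le : rel {set {set T}}) : {set T} :=
  \bigcap_(p in Sprime e w S le) (sepB e w p :|: sepC p).

Definition central_bag (R : realFieldType) (T : finType) (e : rel T) (w : T -> R)
    (S : {set {set {set T}}}) (le : rel {set {set T}})
    (P : {set {set T}} -> seq T) : {set T} :=
  bagZ e w S le :|: \bigcup_(p in Sprime e w S le) [set x in P p].

(* Only the values of [wb] on the central bag are constrained. *)
Definition inherited_weight (R : realFieldType) (T : finType) (e : rel T)
    (w : T -> R) (S : {set {set {set T}}}) (le : rel {set {set T}})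
    (P : {set {set T}} -> seq T) (a : {set {set T}} -> T) (wb : T -> R) : Prop :=
  [/\ forall v, v \in bagZ e w S le -> wb v = w v,
      forall p, p \in Sprime e w S le -> wb (a p) = weight w (Astar e w S le p)
    & forall v, v \in central_bag e w S le P -> v \notin bagZ e w S le ->
        (forall p, p \in Sprime e w S le -> v <> a p) -> wb v = 0].

(* Main.v *)
Require Import Defs.
From mathcomp Require Import all_boot all_order all_algebra.

Set Implicit Arguments.
Unset Strict Implicit.
Unset Printing Implicit Defensive.

Import Order.TTheory GRing.Theory Num.Theory.
Local Open Scope ring_scope.

(* Let U be the union of the sets A(p), p in S.  Loose non-crossing makes U
   disjoint from every C(p), so a component of G[U] meeting A(p) lies inside
   A(p) and attaches only to C(p); hence Z is the complement of U and the sets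
   A*(p) are pairwise anticomplete and partition U.

   Given a balanced separator X of the bag, let Y be obtained by replacing each x
   in X by {x} + delta(x) if x is in Z and by C(p) if x is in A*(p).  A component D of
   G \ Y of weight > 1/2 is not inside any A*(p), since w(A(p)) < 1/2 < w(B(p)).
   So if D meets A*(p), it contains a vertex c of C(p), say in the clique K1.
   As c is not in Y, X avoids both K1 and the interior of the path of p, so c is
   joined to a(p) in the bag minus X.  Thus the retraction v |-> v on Z,
   v |-> a(p) on A*(p), maps D into a single component of the bag minus X, whose
   inherited weight is at least w(D). *)

(** * Components and paths of induced subgraphs *)

Section Components.
Variables (T : finType) (e : rel T).
Hypothesis e_sym : symmetric e.
Implicit Types (D W : {set T}) (u v x y : T).

Lemma induced_rel_sym W : symmetric (induced_rel e W).
Proof. by move=> x y; rewrite /induced_rel /= andbCA e_sym. Qed.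

Lemma connect_ind (r : rel T) (Q : pred T) x y :
  (forall u v, r u v -> Q u -> Q v) -> connect r x y -> Q x -> Q y.
Proof.
move=> step /connectP[p rp ->] {y}; elim: p x rp => //= z p IHp x /andP[rxz rp] Qx.
exact: IHp rp (step _ _ rxz Qx).
Qed.

Lemma mem_components W x :
  x \in W -> [set y | connect (induced_rel e W) x y] \in components e W.
Proof. exact: imset_f. Qed.

Lemma component_sub D W : D \in components e W -> D \subset W.
Proof.
case/imsetP=> x Wx ->; apply/subsetP=> y; rewrite inE => xy.
by apply: (connect_ind (Q := mem W) _ xy) => // u v /and3P[].
Qed.

Lemma component_neq0 D W : D \in components e W -> exists x, x \in D.
Proof. by case/imsetP=> x Wx ->; exists x; rewrite inE. Qed.

Lemma component_closed D W u v :
  D \in components e W -> u \in D -> v \in W -> e u v -> v \in D.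
Proof.
move=> cD Du Wv uv; have Wu := subsetP (component_sub cD) u Du.
case/imsetP: cD Du => x _ ->; rewrite !inE => xu; apply: connect_trans xu _.
by apply: connect1; rewrite /induced_rel /= Wu Wv.
Qed.

Lemma component_conn D W u v :
  D \in components e W -> u \in D -> v \in D -> connect (induced_rel e W) u v.
Proof.
case/imsetP=> x _ ->; rewrite !inE => xu; apply: connect_trans.
by rewrite (sym_connect_sym (@induced_rel_sym W)).
Qed.

Lemma component_eq D D' W x :
  D \in components e W -> D' \in components e W -> x \in D -> x \in D' -> D = D'.
Proof.
have sub D1 D2 : D1 \in components e W -> D2 \in components e W ->
    x \in D1 -> x \in D2 -> D1 \subset D2.
  move=> c1 c2 x1 x2; apply/subsetP=> y y1.
  apply: (connect_ind (Q := mem D2) _ (component_conn c1 x1 y1)) => //.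
  by move=> u v /and3P[_ Wv uv] u2; apply: component_closed c2 u2 Wv uv.
by move=> *; apply/eqP; rewrite eqEsubset !sub.
Qed.

(** The step is required only inside [D], because a walk in [W] that starts in [D] never leaves it.
    This is how whole components are trapped in [sepA] or [Astar]. *)
Lemma component_ind D W (Q : pred T) :
    D \in components e W -> {in D &, forall u v, e u v -> Q u -> Q v} ->
  {in D &, forall u v, Q u -> Q v}.
Proof.
move=> cD step u v Du Dv Qu.
suff /andP[]: (v \in D) && Q v by [].
apply: (connect_ind (Q := [pred z | (z \in D) && Q z]) _ (component_conn cD Du Dv)).
  move=> x y /and3P[_ Wy xy] /andP[Dx Qx].
  have Dy := component_closed cD Dx Wy xy.
  by rewrite /= Dy (step x y).
by rewrite /= Du.
Qed.

(** Meant for a retraction [f], which may send an edge to two vertices that are connected but not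
    adjacent. *)
Lemma component_connect D W (r : rel T) (f : T -> T) :
    D \in components e W ->
    {in D &, forall u v, e u v -> connect r (f u) (f v)} ->
  {in D &, forall u v, connect r (f u) (f v)}.
Proof.
move=> cD step u v Du Dv.
apply: (@component_ind D W (fun z => connect r (f u) (f z)) cD _ u v) => //.
by move=> x y Dx Dy xy ux; apply: connect_trans ux (step x y Dx Dy xy).
Qed.

Lemma induced_path_path x s : induced_path e (x :: s) -> path e x s.
Proof.
case=> _ ind; apply/(pathP x) => i ltis.
by have := ind x i i.+1 (ltnW ltis) ltis; rewrite /= eqxx => ->.
Qed.

Lemma path_induced_rel W x s :
  path e x s -> {subset x :: s <= W} -> path (induced_rel e W) x s.
Proof.
elim: s x => //= y s IHs x /andP[xy ys] sub; rewrite /induced_rel /=.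
rewrite xy !sub ?inE ?eqxx ?orbT //= IHs // => z zs.
by rewrite sub // inE zs orbT.
Qed.

End Components.

(** * Weights of sets, and minima in a total order *)

Lemma weight_sub (R : realFieldType) (T : finType) (w : T -> R) (A B : {set T}) :
  (forall x, 0 <= w x) -> A \subset B -> weight w A <= weight w B.
Proof.
move=> w_ge0 sAB; rewrite /weight (big_setID A (A := B)) /= (setIidPr sAB).
by rewrite lerDl sumr_ge0.
Qed.

Lemma weight_setU (R : realFieldType) (T : finType) (w : T -> R) (A B : {set T}) :
  [disjoint A & B] -> weight w (A :|: B) = weight w A + weight w B.
Proof.
move=> dAB; rewrite /weight -bigU //=.
by apply: eq_bigl => x; rewrite !inE.
Qed.

(* The minimum is the element with the largest up-set. *)
Lemma total_order_min (I : finType) (S Q : {set I}) (le : rel I) :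
    total_order_on S le -> Q \subset S -> Q != set0 ->
  exists2 p, p \in Q & {in Q, forall q, le p q}.
Proof.
move=> [tot _ tr] sQS /set0Pn[p0 Qp0].
pose up p := [set q in Q | le p q].
case: (@arg_maxnP _ p0 (mem Q) (fun p => #|up p|) Qp0) => p Qp pmax.
exists p => // q Qq; have Sp := subsetP sQS p Qp; have Sq := subsetP sQS q Qq.
case: (boolP (le p q)) => // npq.
have qp : le q p by have := tot p q Sp Sq; rewrite (negPf npq).
have: (#|up p| < #|up q|)%N.
  apply: proper_card; apply/properP; split.
    apply/subsetP=> z; rewrite !inE => /andP[Qz pz]; rewrite Qz /=.
    by apply: (tr p q z) => //; apply: (subsetP sQS).
  by exists q; rewrite !inE Qq //=; have := tot q q Sq Sq; rewrite orbb.
by rewrite ltnNge; move: (pmax q Qq) => /= ->.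
Qed.

(** * The sets [A p] and the partition of their union *)

Section CentralBag.
Variables (R : realFieldType) (T : finType) (e : rel T).
Hypothesis e_sym : symmetric e.
Variables (w : T -> R) (S : {set {set {set T}}}) (le : rel {set {set T}}).
Hypothesis S_noncrossing :
  forall p q, p \in S -> q \in S -> loosely_non_crossing e w p q.
Hypothesis le_total : total_order_on S le.

Local Notation A := (sepA e w).
Local Notation B := (sepB e w).
Local Notation U := (unionA e w S).
Local Notation A' := (Astar e w S le).
Local Notation S' := (Sprime e w S le).
Local Notation Z := (bagZ e w S le).

(** [B p] is a full component of the complement of [sepC p], or empty by default, so an edge
    avoiding [sepC p] cannot enter it from outside. *)
Lemma sepA_closed p u v : u \in A p -> v \notin sepC p -> e u v -> v \in A p.
Proof.
rewrite !inE !negb_or => /andP[uB uC] vC uv; rewrite vC andbT.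
apply: contra uB; rewrite /sepB; case: pickP => [D /andP[cD _]|_] /=; last by rewrite inE.
by move=> vD; apply: (component_closed cD vD); rewrite ?inE // e_sym.
Qed.

Lemma sepC_unionA p u : p \in S -> u \in U -> u \notin sepC p.
Proof.
move=> Sp /bigcupP[q Sq uA]; have [_ AC] := S_noncrossing Sp Sq.
by apply/negP=> uC; have: u \in A q :&: sepC p by [rewrite inE uA]; rewrite AC inE.
Qed.

Lemma component_unionA_sub D p u :
  D \in components e U -> p \in S -> u \in D -> u \in A p -> D \subset A p.
Proof.
move=> cD Sp Du Au; apply/subsetP=> v Dv.
apply: (component_ind e_sym (Q := mem (A p)) cD _ Du Dv) => //.
move=> x y Dx Dy xy Ax; apply: (sepA_closed Ax _ xy).
by apply: sepC_unionA => //; apply: (subsetP (component_sub cD)).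
Qed.

Lemma Astar_sub_sepA p : A' p \subset A p.
Proof. by apply/bigcupsP=> D /and3P[]. Qed.

Lemma sub_unionA p : p \in S -> A p \subset U.
Proof. exact: bigcup_sup. Qed.

Lemma Sprime_sub p : p \in S' -> p \in S.
Proof. by rewrite inE => /andP[]. Qed.

(** The component of [u] in [U] belongs to the [le]-least [p] whose [A p] contains it; a candidate
    exists because a component meeting some [A p] lies inside it. *)
Lemma unionA_Astar u : u \in U -> exists2 p, p \in S' & u \in A' p.
Proof.
move=> Uu; have cD := mem_components e Uu.
set D := [set y | _] in cD; have Du : u \in D by rewrite inE.
pose Q := [set p in S | D \subset A p].
have [||p] := @total_order_min _ S Q le le_total.
- by apply/subsetP=> p; rewrite inE => /andP[].
- case/bigcupP: Uu => p Sp Au; apply/set0Pn; exists p.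
  by rewrite inE Sp (component_unionA_sub cD Sp Du).
rewrite inE => /andP[Sp DA] pmin.
have uA : u \in A' p.
  apply/bigcupP; exists D => //; rewrite cD DA; apply/forall_inP=> q Sq.
  by apply/implyP=> Dq; apply: pmin; rewrite inE Sq.
by exists p => //; rewrite inE Sp; apply/set0Pn; exists u.
Qed.

(** Both [p] and [q] are [le]-least for the same component, so antisymmetry identifies them. *)
Lemma Astar_inj p q u : p \in S -> q \in S -> u \in A' p -> u \in A' q -> p = q.
Proof.
move=> Sp Sq /bigcupP[D /and3P[cD Dp /forall_inP minp] Du].
move=> /bigcupP[D' /and3P[cD' Dq /forall_inP minq] Du'].
have eqD := component_eq e_sym cD' cD Du' Du; rewrite eqD in Dq minq.
case: le_total => _ anti _; apply: anti => //.
by rewrite (implyP (minp q Sq)) ?(implyP (minq p Sp)).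
Qed.

Lemma Astar_closed p u v : u \in A' p -> v \in U -> e u v -> v \in A' p.
Proof.
move=> /bigcupP[D cond Du] Uv uv; apply/bigcupP; exists D => //.
by case/and3P: cond => cD _ _; apply: component_closed cD Du Uv uv.
Qed.

Lemma Astar_nbr p u v : p \in S -> u \in A' p -> v \notin U -> e u v -> v \in sepC p.
Proof.
move=> Sp Au Uv uv; apply: contraR Uv => Cv.
by apply: (subsetP (sub_unionA Sp)); apply: sepA_closed (subsetP (Astar_sub_sepA p) u Au) Cv uv.
Qed.

(** [Z] leaves out only the sets [A p] with [p] in [S'], but these already cover [U], since the
    smaller sets [A' p] do. *)
Lemma bagZE : Z = ~: U.
Proof.
apply/setP=> u; rewrite inE; apply/bigcapP/idP => [uZ | Uu p S'p].
  apply/negP=> /unionA_Astar[p S'p /(subsetP (Astar_sub_sepA p))].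
  by rewrite inE uZ.
apply: contraR Uu => uA; apply: (subsetP (sub_unionA (Sprime_sub S'p))).
by rewrite inE.
Qed.

Lemma sepC_sub_bagZ p : p \in S -> sepC p \subset Z.
Proof.
move=> Sp; rewrite bagZE; apply/subsetP=> c Cc; rewrite inE.
by apply: contraL Cc => /(sepC_unionA Sp).
Qed.

Lemma Astar_bagZ p u : p \in S -> u \in A' p -> u \notin Z.
Proof.
move=> Sp Au; rewrite bagZE inE negbK.
by apply: (subsetP (sub_unionA Sp)); apply: (subsetP (Astar_sub_sepA p)).
Qed.

(** * Linking paths inside the bag *)

Variables (P : {set {set T}} -> seq T) (a : {set {set T}} -> T).
Hypothesis P_linking : forall p, p \in S' ->
  exists K1 K2 : {set T}, p = [set K1; K2] /\ linking_path e K1 K2 (A' p) (P p) (a p).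

Local Notation beta := (central_bag e w S le P).

Lemma a_Astar p : p \in S' -> a p \in A' p.
Proof. by case/P_linking=> K1 [K2] [_ [x [y [q [_ _ _ [_ sub] [aq _]]]]]]; apply: sub. Qed.

Lemma P_sub p : p \in S' -> {subset P p <= beta}.
Proof.
move=> S'p u uP; apply/setUP; right; apply/bigcupP; exists p => //.
by rewrite inE.
Qed.

(** Inside the clique, [c] reaches an end of [P p], and the interior leads on to [a p]. As [K'] may
    be either of the two cliques, the path is entered from the end that lies in [K']. *)
Lemma clique_connect_a (W K' : {set T}) p c : p \in S' -> K' \in p -> clique e K' ->
    c \in K' -> K' :&: beta \subset W -> A' p :&: beta \subset W ->
  connect (induced_rel e W) c (a p).
Proof.
move=> S'p pK clK cK sKW sAW.
have KZ z : z \in K' -> z \in W.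
  move=> Kz; apply: (subsetP sKW); rewrite inE Kz; apply/setUP; left.
  apply: (subsetP (sepC_sub_bagZ (Sprime_sub S'p))).
  by apply/bigcupP; exists K'.
have c_conn z : z \in K' -> connect (induced_rel e W) c z.
  move=> Kz; have [<-|cz] := eqVneq c z; first exact: connect0.
  apply: connect1; rewrite /induced_rel /= !KZ //=.
  by apply: (implyP (forall_inP (forall_inP clK c cK) z Kz)).
case: (P_linking S'p) (P_sub S'p) => K1 [K2] [pE [x [y [q [PE ind [xK yK] [q0 sub] [aq _]]]]]].
rewrite PE in ind * => Psub; have pth := induced_path_path ind.
have qW z : z \in q -> z \in W.
  move=> qz; apply: (subsetP sAW); rewrite inE sub //= Psub //.
  by rewrite inE mem_rcons inE qz !orbT.
have /orP[/eqP EK|/eqP EK] : (K' == K1) || (K' == K2).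
- by move: pK; rewrite {1}pE !inE.
- rewrite -EK in xK; apply: connect_trans (c_conn x xK) _.
  have qth : path (induced_rel e W) x q.
    move: pth; rewrite rcons_path => /andP[qth _].
    apply: path_induced_rel => // z; rewrite inE => /predU1P[->|/qW//]; exact: KZ.
  by apply: (path_connect qth); rewrite inE aq orbT.
(* The end [x] is dropped here, since nothing puts it in [W]; the path is followed from [y] back to
   its first interior vertex [h], and from there to [a p]. *)
rewrite -EK in yK; apply: connect_trans (c_conn y yK) _.
case: q q0 aq qW pth {PE ind Psub sub} => // h t _ aq qW /= /andP[_ pth].
have qth : path (induced_rel e W) h (rcons t y).
  apply: path_induced_rel => // z; rewrite -rcons_cons mem_rcons inE.
  by case/predU1P=> [->|/qW//]; apply: KZ.
rewrite (sym_connect_sym (induced_rel_sym e_sym W)).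
apply: (connect_trans (y := h)); last first.
  by apply: (path_connect qth); rewrite -rcons_cons mem_rcons mem_head.
rewrite (sym_connect_sym (induced_rel_sym e_sym W)).
by apply: (path_connect qth); rewrite -rcons_cons mem_rcons inE aq orbT.
Qed.

(* The last branch is junk: a vertex outside Z lies in some A*(p). *)
Definition retract (v : T) : T :=
  if v \in Z then v else if [pick p in S' | v \in A' p] is Some p then a p else v.

Lemma retract_bagZ v : v \in Z -> retract v = v.
Proof. by rewrite /retract => ->. Qed.

Lemma retract_Astar p v : p \in S' -> v \in A' p -> retract v = a p.
Proof.
move=> S'p Av; rewrite /retract (negPf (Astar_bagZ (Sprime_sub S'p) Av)).
case: pickP => [q /andP[S'q Aqv]|/(_ p)]; last by rewrite S'p Av.
by rewrite (@Astar_inj q p v) ?Sprime_sub.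
Qed.

Lemma bagZ_or_Astar v : v \in Z \/ exists2 p, p \in S' & v \in A' p.
Proof.
case: (boolP (v \in U)) => [/unionA_Astar|nU]; first by right.
by left; rewrite bagZE inE.
Qed.

(** * Weight comparison along the retraction *)

Variable wb : T -> R.
Hypothesis wb_inherited : inherited_weight e w S le P a wb.
Hypothesis w_ge0 : forall x, 0 <= w x.

(** Sum over the fibres of [retract]: the fibre of [u] lies in [{u}] if [u] is in [Z], in [A' p] if
    [u = a p], and is empty otherwise. These cases match the three clauses on [wb]. *)
Lemma weight_retract (D D' : {set T}) :
  D' \subset beta -> {in D, forall v, retract v \in D'} -> weight w D <= weight wb D'.
Proof.
case: wb_inherited => wbZ wba wb0 sD' rD.
have fiber u (E : {set T}) : (forall v, v \in D -> retract v = u -> v \in E) ->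
    \sum_(v in D | retract v == u) w v <= weight w E.
  move=> sE; rewrite -(eq_bigl _ _ (in_set [pred v | (v \in D) && (retract v == u)])).
  by apply: weight_sub => //; apply/subsetP=> v; rewrite inE => /andP[Dv /eqP]; apply: sE.
rewrite [X in X <= _](partition_big retract (mem D')) //=; apply: ler_sum => u D'u.
have rP v : retract v = u -> (v \in Z /\ v = u) \/ (exists p, [/\ p \in S', v \in A' p & a p = u]).
  have [Zv | [p S'p Av]] := bagZ_or_Astar v; first by rewrite retract_bagZ //; left.
  by rewrite (retract_Astar S'p Av); right; exists p.
case: (boolP (u \in Z)) => [Zu | nZu].
  rewrite wbZ // -[w u](big_set1 +%R u); apply: fiber => v _ /rP[[_ ->]|]; first by rewrite inE.
  case=> p [S'p _ au]; have := Astar_bagZ (Sprime_sub S'p) (a_Astar S'p).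
  by rewrite au Zu.
case: (boolP [exists p in S', u == a p]) => [/exists_inP[p S'p /eqP ua]|no].
  rewrite [in X in _ <= X]ua wba //; apply: fiber => v _ /rP[[Zv vu]|].
    by rewrite -vu Zv in nZu.
  (* The common vertex [a p = a q] lies in both [A' p] and [A' q], which forces [p = q]. *)
  case=> q [S'q Av au]; rewrite (@Astar_inj p q (a p)) ?Sprime_sub ?a_Astar //.
  by rewrite -ua -au a_Astar.
rewrite wb0 ?(subsetP sD') //; last first.
  by move=> p S'p ua; case/exists_inP: no; exists p => //; apply/eqP.
apply: le_trans (fiber u set0 _) _; last by rewrite /weight big_set0.
move=> v _ /rP[[Zv vu]|]; first by rewrite -vu Zv in nZu.
by case=> p [S'p _ au]; case/exists_inP: no; exists p => //; rewrite au.
Qed.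

(** * Size and weight bounds for a single separation *)

Variable K : int.
Hypothesis S_cliques : forall p, p \in S -> clique_pair e K p.

Lemma clique_pair_clique p K' : p \in S -> K' \in p -> clique e K'.
Proof.
move=> /S_cliques[K1 [K2 [-> [cl1 cl2] _ _]]].
by rewrite !inE => /orP[]/eqP->.
Qed.

Lemma card_sepC p : p \in S -> #|sepC p|%:Z <= 2 * K.
Proof.
move=> /S_cliques[K1 [K2 [-> _ cK1 cK2]]].
have: (#|sepC [set K1; K2]| <= #|K1| + #|K2|)%N.
  apply: leq_trans (leq_card_setU K1 K2); apply: subset_leq_card.
  by apply/bigcupsP=> L; rewrite !inE => /orP[]/eqP->; [exact: subsetUl | exact: subsetUr].
rewrite -lez_nat PoszD => /le_trans; apply.
by rewrite [2 * K]mulrDl mul1r lerD.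
Qed.

Lemma delta_sup p K' x : p \in S -> K' \in p -> x \in K' -> K' \subset delta S x.
Proof.
move=> Sp pK xK; apply: bigcup_sup; rewrite xK; apply/existsP.
case/S_cliques: (Sp) => K1 [K2 [pE _ _ _]].
move: pK; rewrite pE !inE => /orP[]/eqP->; first by exists K2; rewrite -pE.
by exists K1; rewrite setUC -pE.
Qed.

Hypothesis w_total : weight w [set: T] = 1.
Hypothesis G_unbalanced : unbalanced e [set: T] w (2 * K).

(** [sepC p] is too small to be a balanced separator, so some component weighs more than 1/2, hence
    so does the heaviest one, [B p]; [A p] is disjoint from it and the total is 1. *)
Lemma weight_sepA p : p \in S -> weight w (A p) < 1 / 2.
Proof.
move=> Sp; have [D cD wD] : exists2 D, D \in components e (~: sepC p) & 1 / 2 < weight w D.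
  have: ~~ balanced_separator e [set: T] w (sepC p).
    apply: contra G_unbalanced => sep; apply/existsP; exists (sepC p).
    by rewrite sep card_sepC.
  rewrite /balanced_separator subsetT setTD => /forall_inPn[D cD].
  by rewrite -ltNge; exists D.
have wB : 1 / 2 < weight w (B p).
  rewrite /sepB; case: pickP => [E /andP[_ /forall_inP maxE]|].
    exact: lt_le_trans wD (maxE D cD).
  (* A heaviest component exists, so the default [set0] of [sepB] cannot occur. *)
  move=> none.
  case: (@Order.TotalTheory.arg_maxP _ _ _ D (mem (components e (~: sepC p))) (weight w) cD).
  move=> E cE maxE; have /negP[] := negbT (none E); apply/andP; split; first exact: cE.
  exact/forall_inP.
have dAB : [disjoint A p & B p].
  by rewrite disjoint_sym -subsets_disjoint subsetUl.
have := weight_sub w_ge0 (subsetT (A p :|: B p)).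
rewrite weight_setU // w_total {1}(splitr 1) => le1.
by rewrite -(ltrD2r (weight w (B p))); apply: le_lt_trans le1 _; rewrite ltrD2l.
Qed.

(** * Lifting a separator of the bag to the whole graph *)

Variable X : {set T}.

(** [x] is added explicitly because [delta S x] is empty when no clique occurring in [S] contains
    [x]. The inner union has a single term, as the sets [A' p] partition the complement of [Z]. *)
Definition lifted_separator : {set T} :=
  \bigcup_(x in X)
    (if x \in Z then x |: delta S x
     else \bigcup_(p in S' | x \in A' p) sepC p).
Local Notation Y := lifted_separator.

Lemma delta_sub_lifted x : x \in X -> x \in Z -> x |: delta S x \subset Y.
Proof.
by move=> Xx Zx; apply: (bigcup_max x) => //; rewrite Zx.
Qed.

Lemma sepC_sub_lifted p x : p \in S' -> x \in X -> x \in A' p -> sepC p \subset Y.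
Proof.
move=> S'p Xx Ax; apply: (bigcup_max x) => //.
rewrite (negPf (Astar_bagZ (Sprime_sub S'p) Ax)).
by apply: (bigcup_max p); rewrite ?S'p.
Qed.

Lemma card_lifted_separator (m : nat) : (0 < m)%N -> 2 * K <= m%:Z ->
  (forall v, #|delta S v| <= m)%N -> (#|Y| <= #|X| * m)%N.
Proof.
move=> m_gt0 leKm le_delta.
apply: (@leq_trans (\sum_(x in X) m)%N); last by rewrite sum_nat_const.
apply: leq_trans (_ : \sum_(x in X) #|if x \in Z then x |: delta S x
     else \bigcup_(p in S' | x \in A' p) sepC p| <= _)%N.
  rewrite /lifted_separator; elim/big_rec2: _ => [|x k C _ IH]; first by rewrite cards0.
  by apply: leq_trans (leq_card_setU _ _) _; rewrite leq_add2l.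
apply: leq_sum => x Xx; case: ifP => [Zx|nZx].
  (* Either [x] already belongs to [delta S x], or [delta S x] is empty and the one vertex left is
     absorbed by [0 < m]. *)
  case: (boolP (x \in delta S x)) => [dx|ndx].
    by rewrite (setUidPr _) ?sub1set.
  rewrite (_ : delta S x = set0) ?setU0 ?cards1 //.
  apply/setP=> y; rewrite inE; apply/bigcupP=> -[K' /andP[xK ex] _].
  by case/negP: ndx; apply/bigcupP; exists K'; rewrite ?xK.
have [|[p S'p Ax]] := bagZ_or_Astar x; first by rewrite nZx.
rewrite (big_pred1 p) => [|q].
  by rewrite -lez_nat; apply: le_trans leKm; apply/card_sepC/Sprime_sub.
apply/andP/eqP => [[S'q Aq]|-> //].
by apply: Astar_inj Aq Ax; apply: Sprime_sub.
Qed.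

(** If [X] met the clique of [c] at [z], then [delta S z] would put [c] in [Y]; if [X] met [A' p],
    then all of [sepC p] would lie in [Y]. Both contradict [c] being in [D]. *)
Lemma lifted_separator_connect (D : {set T}) p c :
    p \in S' -> D \subset ~: Y -> c \in D -> c \in sepC p ->
  connect (induced_rel e (beta :\: X)) c (a p).
Proof.
move=> S'p sDY Dc /bigcupP[K' pK cK]; have Sp := Sprime_sub S'p.
have nYc : c \notin Y by have := subsetP sDY c Dc; rewrite inE.
apply: (clique_connect_a S'p pK (clique_pair_clique Sp pK) cK).
  apply/subsetP=> z /setIP[Kz bz]; rewrite inE bz andbT.
  apply: contra nYc => Xz; have Zz : z \in Z.
    by apply: (subsetP (sepC_sub_bagZ Sp)); apply/bigcupP; exists K'.
  apply: (subsetP (delta_sub_lifted Xz Zz)); apply/setUP; right.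
  exact: (subsetP (delta_sup Sp pK Kz)).
apply/subsetP=> z /setIP[Az bz]; rewrite inE bz andbT.
apply: contra nYc => Xz; apply: (subsetP (sepC_sub_lifted S'p Xz Az)).
by apply/bigcupP; exists K'.
Qed.

Lemma lifted_separator_balanced :
  balanced_separator e beta wb X -> balanced_separator e [set: T] w Y.
Proof.
case/andP=> sXb /forall_inP Xbal; rewrite /balanced_separator subsetT /= setTD.
apply/forall_inP=> D cD; have sDY := component_sub cD.
rewrite leNgt; apply/negP=> wD.
have [z Dz Zz] : exists2 z, z \in D & z \in Z.
  apply/exists_inP; apply: contraLR wD => /exists_inPn DZ.
  have [u Du] := component_neq0 cD; rewrite -leNgt.
  have [Zu|[p S'p Au]] := bagZ_or_Astar u; first by rewrite (negPf (DZ u Du)) in Zu.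
  apply/ltW/(le_lt_trans _ (weight_sepA (Sprime_sub S'p)))/weight_sub => //.
  apply: subset_trans (Astar_sub_sepA p); apply/subsetP=> v Dv.
  apply: (component_ind e_sym (Q := mem (A' p)) cD _ Du Dv) => // x y _ Dy xy Ax.
  by apply: Astar_closed Ax _ xy; have := DZ y Dy; rewrite bagZE inE negbK.
have DZb u : u \in D -> u \in Z -> u \in beta :\: X.
  move=> Du Zu; apply/setDP; split; first by apply/setUP; left.
  have := subsetP sDY u Du; rewrite inE; apply: contra => Xu.
  by apply: (subsetP (delta_sub_lifted Xu Zu)); rewrite !inE eqxx.
have conn : {in D &, forall u v, connect (induced_rel e (beta :\: X)) (retract u) (retract v)}.
  (* An edge between [Z] and [A' p] has its end in [Z] inside [sepC p], and that end is connected to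
     [a p]. *)
  have mixed u v p : u \in D -> u \in Z -> p \in S' -> v \in A' p -> e u v ->
      connect (induced_rel e (beta :\: X)) (retract u) (retract v).
    move=> Du Zu S'p Av uv; rewrite (retract_bagZ Zu) (retract_Astar S'p Av).
    apply: (lifted_separator_connect S'p sDY Du).
    apply: (Astar_nbr (Sprime_sub S'p) Av); last by rewrite e_sym.
    by move: Zu; rewrite bagZE inE.
  apply: (component_connect e_sym cD) => u v Du Dv uv.
  have [Zu|[p S'p Au]] := bagZ_or_Astar u; have [Zv|[q S'q Av]] := bagZ_or_Astar v.
  - rewrite !retract_bagZ //; apply: connect1.
    by rewrite /induced_rel /= uv !DZb.
  - exact: mixed Du Zu S'q Av uv.
  - rewrite (sym_connect_sym (induced_rel_sym e_sym _)).
    by apply: mixed Dv Zv S'p Au _; rewrite e_sym.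
  (* With both ends outside [Z], the edge stays in one [A' p] and collapses to [a p]. *)
  have Uv : v \in U by have := Astar_bagZ (Sprime_sub S'q) Av; rewrite bagZE inE negbK.
  by rewrite (retract_Astar S'p Au) (retract_Astar S'p (Astar_closed Au Uv uv)).
(* The target is the component of [z], which the retraction fixes. *)
have cD' := mem_components e (DZb z Dz Zz).
move: wD; apply/negP; rewrite -leNgt; apply: le_trans (Xbal _ cD').
apply: weight_retract => [|v Dv].
  exact: subset_trans (component_sub cD') (subsetDl _ _).
by rewrite inE -{1}(retract_bagZ Zz); apply: conn.
Qed.

End CentralBag.

Theorem theorem4p5 (R : realFieldType) (T : finType) (e : rel T)
    (e_sym : symmetric e) (e_irr : irreflexive e)
    (w : T -> R) (w_weight : weight_function w)
    (K : int) (K_gt0 : 0 < K)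
    (G_unbalanced : unbalanced e [set: T] w (2 * K))
    (S : {set {set {set T}}})
    (S_cliques : forall p, p \in S -> clique_pair e K p)
    (S_noncrossing : forall p q, p \in S -> q \in S -> loosely_non_crossing e w p q)
    (le : rel {set {set T}}) (P : {set {set T}} -> seq T) (a : {set {set T}} -> T)
    (bag_data : central_bag_data e w S le P a)
    (wb : T -> R) (wb_inherited : inherited_weight e w S le P a wb)
    (d Delta : int)
    (delta_le : forall v : T, #|delta S v|%:Z <= Delta)
    (bag_balanced : balanced e (central_bag e w S le P) wb d) :
  balanced e [set: T] w (Num.max (2 * K * d) (Delta * d)).
Proof.
case: bag_data => le_total P_linking; case: w_weight => w_bound w_total.
have w_ge0 x : 0 <= w x by case/andP: (w_bound x).
case/existsP: bag_balanced => X /andP[sepX leXd].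
have d_ge0 : 0 <= d by apply: le_trans leXd.
(* As [d] is nonnegative it factors out of the maximum, leaving one constant [M] that bounds the
   contribution of each vertex of [X]. Positivity of [K] makes [M] a positive natural number, as the
   counting lemma requires. *)
rewrite -maxr_pMl //; set M := Num.max _ _.
have leKM : 2 * K <= M by rewrite le_max lexx.
have leDM : Delta <= M by rewrite le_max lexx orbT.
have M_gt0 : 0 < M by apply: lt_le_trans leKM; rewrite mulr_gt0.
have ME : M = `|M|%N :> int by rewrite gtz0_abs.
apply/existsP; exists (lifted_separator e w S le X); apply/andP; split.
  exact: (lifted_separator_balanced e_sym S_noncrossing le_total P_linking
            wb_inherited w_ge0 S_cliques w_total G_unbalanced).
have := @card_lifted_separator _ _ _ e_sym _ _ _ S_noncrossing le_total _ S_cliques X `|M|%N.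
rewrite -ltz_nat -ME => /(_ M_gt0 leKM).
have dM v : (#|delta S v| <= `|M|)%N by rewrite -lez_nat -ME (le_trans (delta_le v)).
move=> /(_ dM); rewrite -lez_nat PoszM -ME => /le_trans; apply.
by rewrite [M * d]mulrC ler_wpM2r // ltW.
Qed.
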